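(* Let $G:\mathbb{R}^+\times H\to P(H)$ be a multivalued semiflow on a Banach space $H$ such that the following conditions hold: (i) $G$ satisfies the flattening condition; (ii) $G$ is point dissipative; (iii) at least one of the following two conditions holds: (A) $G$ satisfies the condition ($NW$); (B) $H$ is reflexive and $G$ is demiclosed. Then $G$ has a bounded absorbing set and, in consequence, $G$ has a (compact) global attractor.
   Context: $\mathbb{R}^+=[0,\infty)$; $P(H)$ is the family of all nonempty subsets of $H$. A map $G:\mathbb{R}^+\times H\to P(H)$ is a multivalued semiflow ($m$-semiflow) if (1) $G(0,z)=\{z\}$ for all $z\in H$, and (2) $G(t+s,z)\subset G(t,G(s,z))$ for all $z\in H$ and $t,s\ge 0$. For $B\subset H$, $G(t,B)=\bigcup_{x\in B}G(t,x)$. For $A,B\subset H$, $\mathrm{dist}_H(A,B)=\sup_{x\in A}\inf_{y\in B}\|x-y\|$. $G$ satisfies the flattening condition if for every bounded $B\subset H$ and $\epsilon>0$ there exist $t_0=t_0(B,\epsilon)$ and a finite dimensional subspace $E$ of $H$ such that for a bounded projector $P:H\to E$ the set $P\big(\bigcup_{t\ge t_0}G(t,B)\big)$ is bounded in $H$ and $(I-P)\big(\bigcup_{t\ge t_0}G(t,B)\big)\subset B(0,\epsilon)$, where $B(0,\epsilon)$ is the closed ball of radius $\epsilon$ centered at $0$. Here a bounded projector onto $E$ is a map $P:H\to E$, not necessarily linear, with $Px=x$ for $x\in E$, mapping bounded sets to bounded sets. $G$ is point dissipative if there exists a bounded set $B_0\subset H$ such that for every $x\in H$, $\mathrm{dist}_H(G(t,x),B_0)\to0$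 as $t\to\infty$. $G$ satisfies condition ($NW$) if for every $t\ge0$: whenever $x_n\to x$ in norm in $H$ and $\xi_n\in G(t,x_n)$, there exists a subsequence $\xi_{k_n}$ converging weakly in $H$ to some $\xi\in G(t,x)$. $G$ is demiclosed if for all $t\ge0$ the graph of $x\mapsto G(t,x)$ is closed in $H\times H$ with the strong (norm) topology on the argument space and the weak topology on the value space. $G$ has a bounded absorbing set if there exists a bounded set $B_1\subset H$ such that for any bounded $B\subset H$ there exists $t_0>0$ with $\bigcup_{t\ge t_0}G(t,B)\subset B_1$. A set $A\subset H$ is a global attractor for $G$ if (1) $A$ is compact in $H$; (2) $A\subset G(t,A)$ for all $t\ge0$; (3) for every bounded $B\subset H$, $\mathrm{dist}_H(G(t,B),A)\to0$ as $t\to\infty$. *)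

(* Defs.v *)
From mathcomp Require Import all_boot all_order all_algebra.
From mathcomp Require Import all_classical all_reals all_analysis.

Set Implicit Arguments.
Unset Strict Implicit.
Unset Printing Implicit Defensive.

Import Order.TTheory GRing.Theory Num.Theory.
Import numFieldNormedType.Exports.

Local Open Scope classical_set_scope.
Local Open Scope ring_scope.

Section dual_and_weak_topology.
Context {R : realType}.

Definition dual_space (H : normedModType R) : set (H -> R^o) :=
  [set f | linear f /\ continuous f].

Definition dual_norm (H : normedModType R) (f : H -> R^o) : R :=
  sup [set `|f x| | x in [set x : H | `|x| <= 1]].

(* Bounded linear functionals on (dual_space H, dual_norm). Only the values of
   Phi on dual_space H are relevant. *)
Definition bidual_space (H : normedModType R) : set ((H -> R^o) -> R^o) :=
  [set Phi |
    (forall (a : R) (f g : H -> R^o), dual_space f -> dual_space g ->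
       Phi (a *: f + g) = a *: Phi f + Phi g) /\
    exists C : R, forall f : H -> R^o, dual_space f ->
       `|Phi f| <= C * dual_norm f].

(* Surjectivity of the canonical embedding x |-> (f |-> f x) into the bidual. *)
Definition reflexive_space (H : normedModType R) : Prop :=
  forall Phi : (H -> R^o) -> R^o, bidual_space Phi ->
    exists x : H, forall f : H -> R^o, dual_space f -> Phi f = f x.

(* H with the coarsest topology that makes every element of dual_space H
   continuous. *)
Definition weak (H : normedModType R) : topologicalType :=
  sup_topology (fun f : {f : H -> R^o | dual_space f} =>
    Topological.class (initial_topology (sval f))).

Lemma weak_cvgP (H : normedModType R) (u : nat -> H) (x : H) :
  ((u : nat -> weak H) @ \oo --> (x : weak H)) <->
  (forall f : H -> R^o, dual_space f -> f (u n) @[n --> \oo] --> f x).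
Proof.
rewrite cvg_sup; split=> [ux f Hf|ux [f Hf]] /=.
- move=> A fxA; apply: (ux (exist _ f Hf) (f @^-1` A)).
  exact: (@initial_continuous H R^o f x A fxA).
- move=> A /=; rewrite (@nbhsE (initial_topology f)) => -[B [[C oC CB] Bx] BA].
  have Cfx : C (f x) by move: Bx; rewrite -CB.
  have uC : \forall n \near \oo, C (f (u n)).
    exact: (ux f Hf C (open_nbhs_nbhs (conj oC Cfx))).
  apply: (@filterS _ \oo _ _ _ _ uC) => n Cn; apply: BA.
  by rewrite -CB.
Qed.

End dual_and_weak_topology.

Section semidistance.
Context {R : realType} {H : normedModType R}.
Local Open Scope ereal_scope.

(* The supremum is taken in [0, +oo], so that the value is 0 when A is empty
   (ereal_sup set0 is -oo); the infimum over an empty B is +oo. *)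
Definition semidist (A B : set H) : \bar R :=
  maxe 0 (ereal_sup
    [set ereal_inf [set `|x - y|%:E | y in B] | x in A]).

End semidistance.

Section multivalued_semiflow.
Context {R : realType} {H : normedModType R}.

(* Time ranges over all of R, but only the values G t z with 0 <= t matter. *)
Implicit Types (G : R -> H -> set H) (A B E : set H).

Definition flow_image G (t : R) B : set H := \bigcup_(x in B) G t x.

Definition flow_tail G (t0 : R) B : set H :=
  \bigcup_(t in [set t | t0 <= t]) flow_image G t B.

Record m_semiflow G : Prop := MSemiflow {
  m_semiflow_neq0 : forall (t : R) (z : H), 0 <= t -> G t z !=set0 ;
  m_semiflow0 : forall z, G 0 z = [set z] ;
  m_semiflowD : forall (t s : R) (z : H), 0 <= t -> 0 <= s ->
    G (t + s) z `<=` flow_image G t (G s z) }.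

Definition finite_dim_subspace E : Prop :=
  exists (n : nat) (e : 'I_n -> H),
    E = [set \sum_(i < n) c i *: e i | c in [set: 'I_n -> R]].

(* P is not assumed to be linear or continuous. *)
Record bounded_projector E (P : H -> H) : Prop := BoundedProjector {
  bounded_projector_in : forall x, E (P x) ;
  bounded_projector_id : forall x, E x -> P x = x ;
  bounded_projector_bounded : forall B, bounded_set B -> bounded_set (P @` B) }.

Definition flattening G : Prop :=
  forall B (eps : R), bounded_set B -> 0 < eps ->
    exists (t0 : R) E (P : H -> H),
      [/\ 0 <= t0, finite_dim_subspace E, bounded_projector E P,
          bounded_set (P @` flow_tail G t0 B) &
          [set x - P x | x in flow_tail G t0 B] `<=` [set y | `|y| <= eps]].

Definition point_dissipative G : Prop :=
  exists2 B0, bounded_set B0 &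
    forall x, semidist (G t x) B0 @[t --> +oo] --> 0%E.

Definition condition_NW G : Prop :=
  forall (t : R) (x_ : nat -> H) (x : H) (xi : nat -> H),
    0 <= t -> x_ n @[n --> \oo] --> x -> (forall n, G t (x_ n) (xi n)) ->
    exists (k : nat -> nat) (l : H),
      [/\ {homo k : m n / (m < n)%N >-> (m < n)%N}, G t x l &
          (xi \o k : nat -> weak H) @ \oo --> (l : weak H)].

Definition demiclosed G : Prop :=
  forall t : R, 0 <= t -> closed [set p : H * weak H | G t p.1 p.2].

Definition bounded_absorbing_set G B1 : Prop :=
  bounded_set B1 /\
  forall B, bounded_set B -> exists2 t0 : R, 0 < t0 & flow_tail G t0 B `<=` B1.

Record global_attractor G A : Prop := GlobalAttractor {
  global_attractor_compact : compact A ;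
  global_attractor_neginv : forall t : R, 0 <= t -> A `<=` flow_image G t A ;
  global_attractor_attracts : forall B, bounded_set B ->
    semidist (flow_image G t B) A @[t --> +oo] --> 0%E }.

End multivalued_semiflow.

(* Main.v *)
From HB Require Import structures.
Require Import Defs.
From mathcomp Require Import all_boot all_order all_algebra.
From mathcomp Require Import all_classical all_reals all_analysis.
From mathcomp Require Import lra.

(** Flattening makes the semiflow asymptotically compact: for a bounded set
    [B] and each [eps], the late images of [B] lie within [eps] of a bounded
    part of a finite-dimensional subspace. By completeness, a family whose
    members eventually enter every tail of [B] therefore converges along every
    ultrafilter ([flattening_ultra_cvg]). It follows that the omega-limit set
    of [B] is compact, and that sequences [u n] in the tails of [B] after time
    [n] have subsequences converging to a point of it
    ([omega_limit_subseq]).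

    Both alternatives of the last hypothesis give the same closedness
    property ([weakly_closed_graph]): if [x_ n] tends to [x] in norm and
    [w n] in [G t (x_ n)] is bounded, then along some ultrafilter finer than
    [\oo] the sequence [w] tends weakly to a point of [G t x]. In a reflexive
    space the weak limit is the point representing the functional
    [f |-> lim f (w n)] of the bidual.

    The bounded absorbing set is the crux, because the images [G t (x_ n)]
    need not be close to [G t x] in norm when [x_ n] is close to [x]. Let [r]
    be such that, for each [x], [G t x] is in the ball of radius [r] for [t]
    large. Let [eta] converge to [y], and take [s] so large that [G s y] is in
    this ball and that the tail of the range of [eta] after time [s] is flattened with
    [eps = 1]. If [w n] is in [G s (eta n)], then along an ultrafilter [w]
    tends weakly to a point [l] of [G s y], while it ends up within distance 2
    of the limit [p] of its finite-dimensional approximations. Closed balls are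
    weakly closed (Hahn-Banach), so [l] is also within distance 2 of [p], and
    infinitely many [w n] are in the ball [D] of radius [r + 4]
    ([flattening_enters_ball]).

    A bounded tail of [D] is then absorbing. Otherwise there are [y_ n] outside
    of it with [y_ n] in [G n (m n)], where [m n] is in the tail of some bounded
    set after time [n]; along a subsequence [m] converges, so that the
    orbits from [m n] to [y_ n] meet [D] at a fixed time [s] for infinitely many
    [n], which forces such [y_ n] into the tail of [D].

    The attractor is the omega-limit set of the absorbing set. *)

Set Implicit Arguments.
Unset Strict Implicit.
Unset Printing Implicit Defensive.

Import Order.TTheory GRing.Theory Num.Theory.
Import numFieldNormedType.Exports.

Local Open Scope classical_set_scope.
Local Open Scope ring_scope.

(** * Bounded sets and ultrafilters *)

Lemma bounded_setP (R : realType) (V : normedModType R) (B : set V) :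
  bounded_set B <-> exists M : R, forall x, B x -> `|x| <= M.
Proof.
split=> [[M [_ HM]]|[M HM]].
  by exists (M + 1) => x Bx; apply: (HM (M + 1)) => //; rewrite ltrDl.
exists M; split; first exact: num_real.
by move=> N MN x Bx; apply: le_trans (HM x Bx) (ltW MN).
Qed.

Lemma ultra_fmap (T U : Type) (f : T -> U) (F : set_system T) :
  UltraFilter F -> UltraFilter (f @ F).
Proof.
move=> UF; split; first exact: fmap_proper_filter.
move=> G PG FG; apply/seteqP; split=> // A GA.
have [//|FnA] := in_ultra_setVsetC (f @^-1` A) UF.
have GnA : G (~` A) by apply: FG.
have := filterI GA GnA; rewrite setICr => G0.
by case: (@filter_not_empty _ G _ (G0 _)).
Qed.

Lemma ultra_bounded_cvg (R : realType) (T : Type) (F : set_system T)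
    (u : T -> R) (M : R) :
  UltraFilter F -> (\forall t \near F, `|u t| <= M) ->
  exists l : R, u t @[t --> F] --> l.
Proof.
move=> UF uM.
have := @segment_compact R (- M) M; rewrite compact_ultra => cM.
have [|l [_ ul]] := cM (u @ F) (ultra_fmap u UF); last by exists l.
apply: (@filterS _ F _ _ _ _ uM) => t /=.
by rewrite in_itv /= ler_norml.
Qed.

(** * Norming functionals *)

Section hahn_banach.
Context {R : realType} {V : normedModType R}.
Implicit Types (q f : V -> R) (x y : V).

(** Sublinear functionals below the norm. For positive scalars the inequality
    [q (c *: x) <= c * q x] implies the equality, by applying it to [c^-1]. *)
Record sublinear q : Prop := Sublinear {
  sublinearD : forall x y, q (x + y) <= q x + q y ;
  sublinearZ : forall (c : R) x, 0 < c -> q (c *: x) <= c * q x ;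
  sublinear_le_norm : forall x, q x <= `|x| }.

Lemma sublinear0 q : sublinear q -> q 0 = 0.
Proof.
move=> [qD _ qn]; apply/eqP; rewrite eq_le -{1}(normr0 V) qn /=.
by have := qD 0 0; rewrite addr0; lra.
Qed.

Lemma sublinear_ge q x : sublinear q -> - `|x| <= q x.
Proof.
move=> Sq; have := sublinearD Sq x (- x); rewrite subrr sublinear0 //.
by have := sublinear_le_norm Sq (- x); rewrite normrN; lra.
Qed.

(** The infimum over [t >= 0] of [q (y + t *: x) - t * q x]. When [q] is
    sublinear, this is a sublinear functional below [q] whose value at [- x] is
    at most [- q x]. *)
Definition sublinear_dir q x y : R :=
  inf [set q (y + t *: x) - t * q x | t in [set t : R | 0 <= t]].

Lemma sublinear_dir_le q x y (t : R) : sublinear q -> 0 <= t ->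
  sublinear_dir q x y <= q (y + t *: x) - t * q x.
Proof.
move=> Sq t0; apply: ge_inf; last by exists t.
exists (- `|y|) => _ [s /= s0 <-].
have [->|sn0] := eqVneq s 0.
  by rewrite scale0r addr0 mul0r subr0; exact: sublinear_ge.
have sp : 0 < s by rewrite lt_def sn0.
have := sublinearD Sq (y + s *: x) (- y).
rewrite addrAC subrr add0r.
have := sublinearZ Sq (s *: x) (c := s^-1).
rewrite scalerA mulVf // scale1r invr_gt0 => /(_ sp) H1 H2.
have : s * q x <= q (s *: x) by rewrite -ler_pdivlMl.
have := sublinear_le_norm Sq (- y); rewrite normrN; lra.
Qed.

Lemma le_sublinear_dir q x y (m : R) :
  (forall t : R, 0 <= t -> m <= q (y + t *: x) - t * q x) ->
  m <= sublinear_dir q x y.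
Proof.
move=> H; apply: lb_le_inf; first by eexists; exists 0; first exact: lexx.
by move=> _ [t /= t0 <-]; exact: H.
Qed.

Lemma sublinear_dir_le_self q x y : sublinear q -> sublinear_dir q x y <= q y.
Proof.
by move=> Sq; have := sublinear_dir_le x y Sq (lexx 0);
  rewrite scale0r addr0 mul0r subr0.
Qed.

Lemma sublinear_dirP q x : sublinear q -> sublinear (sublinear_dir q x).
Proof.
move=> Sq; split.
- move=> y z; rewrite -lerBlDr; apply: le_sublinear_dir => s s0.
  rewrite lerBlDr [leRHS]addrC -lerBlDr; apply: le_sublinear_dir => t t0.
  have := sublinear_dir_le x (y + z) Sq (addr_ge0 t0 s0).
  have := sublinearD Sq (z + t *: x) (y + s *: x).
  have -> : z + t *: x + (y + s *: x) = y + z + (t + s) *: x.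
    by rewrite scalerDl addrACA (addrC z).
  lra.
- move=> c y c0; rewrite -ler_pdivrMl //.
  apply: le_sublinear_dir => t t0; rewrite ler_pdivrMl //.
  have := sublinear_dir_le x (c *: y) Sq (mulr_ge0 (ltW c0) t0).
  have := sublinearZ Sq (y + t *: x) c0.
  rewrite scalerDr scalerA mulrBr mulrA; lra.
- move=> y; apply: le_trans (sublinear_dir_le_self _ _ Sq) _.
  exact: sublinear_le_norm.
Qed.

Lemma sublinear_dirN q x : sublinear q -> sublinear_dir q x (- x) <= - q x.
Proof.
move=> Sq; have := sublinear_dir_le x (- x) Sq ler01.
by rewrite scale1r mul1r addNr sublinear0 // add0r.
Qed.

(** A minimal sublinear functional is linear, as it equals each of its
    [sublinear_dir]. *)
Lemma minimal_sublinear_linear q : sublinear q ->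
  (forall p, sublinear p -> (forall x, p x <= q x) -> p = q) ->
  linear (q : V -> R^o).
Proof.
move=> Sq qmin.
have qN x : q (- x) = - q x.
  have := sublinear_dirN x Sq.
  rewrite (qmin _ (sublinear_dirP x Sq)) => [|y]; last first.
    exact: sublinear_dir_le_self.
  have := sublinearD Sq x (- x); rewrite subrr sublinear0 //; lra.
have qD x y : q (x + y) = q x + q y.
  have := sublinearD Sq x y; have := sublinearD Sq (- x) (- y).
  rewrite -opprD !qN; lra.
have qZp (c : R) x : 0 < c -> q (c *: x) = c * q x.
  move=> c0; apply/eqP; rewrite eq_le sublinearZ //=.
  have := sublinearZ Sq (- x) c0; rewrite scalerN !qN; lra.
have qZ (c : R) x : q (c *: x) = c * q x.
  have [c0|c0|<-] := ltgtP 0 c; first exact: qZp.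
    have := qZp (- c) x; rewrite oppr_gt0 c0 scaleNr qN => /(_ isT); lra.
  by rewrite scale0r mul0r sublinear0.
by move=> c x y; rewrite qD qZ.
Qed.

(** Zorn's lemma: the infimum of a chain of sublinear functionals is
    sublinear. *)
Lemma ex_minimal_sublinear q : sublinear q -> exists p, [/\ sublinear p,
  forall x, p x <= q x &
  forall p', sublinear p' -> (forall x, p' x <= p x) -> p' = p].
Proof.
move=> Sq.
pose T := {p : V -> R | sublinear p /\ forall x, p x <= q x}.
pose le (p p' : T) : bool := `[< forall x, sval p' x <= sval p x >].
have [||||[p [Sp pq]] pmin] := @Zorn T le.
- by move=> p; apply/asboolP.
- move=> p1 p2 p3 /asboolP H1 /asboolP H2; apply/asboolP => x.
  exact: le_trans (H2 x) (H1 x).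
- move=> [p1 H1] [p2 H2] /asboolP /= H12 /asboolP /= H21.
  by apply: eq_exist => /=; apply/funext => x; apply/eqP; rewrite eq_le H12 H21.
- move=> A Atot.
  have [[p0 Ap0]|A0] := pselect (exists p, A p); last first.
    exists (exist _ q (conj Sq (fun x => lexx _))) => p Ap.
    by exfalso; apply: A0; exists p.
  pose m x : R := inf [set sval p x | p in A].
  have mle (p : T) x : A p -> m x <= sval p x.
    move=> Ap; apply: ge_inf; last by exists p.
    exists (- `|x|) => _ [r _ <-].
    exact: sublinear_ge (proj1 (svalP r)).
  have lb_m (c : R) x : (forall p : T, A p -> c <= sval p x) -> c <= m x.
    move=> H; apply: lb_le_inf; first by exists (sval p0 x), p0.
    by move=> _ [p Ap <-]; exact: H.
  have mq x : m x <= q x.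
    exact: le_trans (mle _ _ Ap0) (proj2 (svalP p0) x).
  have Sm : sublinear m.
    split.
    - move=> x y; rewrite -lerBlDr; apply: (lb_m) => p1 A1.
      rewrite lerBlDr [leRHS]addrC -lerBlDr; apply: (lb_m) => p2 A2.
      rewrite lerBlDr.
      have [/asboolP H|/asboolP H] := Atot _ _ A1 A2.
      + have := mle _ (x + y) A2; have := sublinearD (proj1 (svalP p2)) x y.
        have := H x; lra.
      + have := mle _ (x + y) A1; have := sublinearD (proj1 (svalP p1)) x y.
        have := H y; lra.
    - move=> c x c0; rewrite -ler_pdivrMl //; apply: (lb_m) => p Ap.
      rewrite ler_pdivrMl //.
      by apply: le_trans (mle _ _ Ap) (sublinearZ (proj1 (svalP p)) _ c0).
    - by move=> x; apply: le_trans (mq x) (sublinear_le_norm Sq x).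
  exists (exist _ m (conj Sm mq)) => p Ap.
  by apply/asboolP => x /=; exact: mle.
- exists p; split=> // p' Sp' p'p.
  have p'q x : p' x <= q x by apply: le_trans (p'p x) (pq x).
  pose t : T := exist _ p' (conj Sp' p'q).
  suff /(congr1 sval) : t = exist _ p (conj Sp pq) by [].
  by apply: pmin; apply/asboolP.
Qed.

(** Hahn-Banach: a minimal sublinear functional below [sublinear_dir] of the
    norm in the direction [x] is linear, and at most [- `|x|] at [- x]. *)
Lemma norming_functional x : exists f : V -> R^o,
  [/\ dual_space f, forall y, f y <= `|y| & f x = `|x|].
Proof.
have Sn : sublinear (fun y => `|y|).
  by split=> [y z|c y c0|//]; rewrite ?ler_normD// normrZ gtr0_norm.
have [f [Sf fle fmin]] := ex_minimal_sublinear (sublinear_dirP x Sn).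
have flin := minimal_sublinear_linear Sf fmin.
pose fL := HB.pack_for {linear V -> R^o} (f : V -> R^o)
  (GRing.isLinear.Build R V R^o *:%R f flin).
have fn y : `|f y| <= `|y|.
  rewrite ler_norml sublinear_ge //=; exact: sublinear_le_norm.
exists f; split.
- split=> //; apply: (@bounded_linear_continuous R V R^o fL).
  apply/ex_bound; exists 1.
  have : \forall y \near (0 : V), `|y| < 1.
    by apply: (@cvgr_norm_lt R V _ _ _ id 0) => //; rewrite normr0.
  by apply: filterS => y /= /ltW; apply: le_trans.
- exact: sublinear_le_norm.
- apply/eqP; rewrite eq_le (sublinear_le_norm Sf) /=.
  have := fle (- x); have := sublinear_dirN x Sn.
  by have /= := sublinearD Sf x (- x); rewrite subrr sublinear0 //; lra.
Qed.

End hahn_banach.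

(** * Finite-dimensional approximation *)

Section finite_dimension.
Context {R : realType} {V : normedModType R}.

(** The linear span of a finite family, not assumed independent. *)
Definition lin_span n (e : 'I_n -> V) : set V :=
  [set \sum_(i < n) c i *: e i | c in [set: 'I_n -> R]].

Lemma lin_spanZ n (e : 'I_n -> V) (a : R) x :
  lin_span e x -> lin_span e (a *: x).
Proof.
move=> [c _ <-]; exists (fun i => a * c i) => //.
by rewrite scaler_sumr; apply: eq_bigr => i _; rewrite scalerA.
Qed.

Lemma lin_spanD n (e : 'I_n -> V) x y :
  lin_span e x -> lin_span e y -> lin_span e (x + y).
Proof.
move=> [c _ <-] [d _ <-]; exists (fun i => c i + d i) => //.
by rewrite -big_split; apply: eq_bigr => i _; rewrite scalerDl.
Qed.

Lemma lin_span_recl n (e : 'I_n.+1 -> V) x : lin_span e x <->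
  exists a y, lin_span (e \o lift ord0) y /\ x = a *: e ord0 + y.
Proof.
split=> [[c _ <-]|[a [y [[c _ <-] ->]]]].
  exists (c ord0), (\sum_(i < n) c (lift ord0 i) *: e (lift ord0 i)).
  by split; [exists (c \o lift ord0)|rewrite big_ord_recl].
exists (fun i => if unlift ord0 i is Some j then c j else a) => //.
rewrite big_ord_recl unlift_none; congr (_ + _).
by apply: eq_bigr => i _; rewrite liftK.
Qed.

(** Bounded families in a finite-dimensional subspace converge along
    ultrafilters, to a limit in the subspace. The generators need not be
    independent: if the coefficients of the first one are unbounded, dividing
    by them shows that it lies in the (closed) span of the others. *)
Lemma lin_span_ultra_cvg n (e : 'I_n -> V) (T : Type) (F : set_system T)
    (p : T -> V) (M : R) : UltraFilter F ->
  (\forall t \near F, lin_span e (p t)) ->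
  (\forall t \near F, `|p t| <= M) ->
  exists l, lin_span e l /\ p t @[t --> F] --> l.
Proof.
move=> UF; elim: n e p M => [|n IH] e p M pe pM.
  exists 0; split; first by exists (fun=> 0) => //; rewrite big_ord0.
  apply: (@cvg_trans _ ((fun=> 0) @ F)); last exact: cvg_cst.
  apply: near_eq_cvg; apply: filterS pe => t [c _ <-].
  by rewrite big_ord0.
pose e' := e \o lift ord0.
have /choice[ay ayE] (t : T) : exists ay : R * V, lin_span e (p t) ->
    lin_span e' ay.2 /\ p t = ay.1 *: e ord0 + ay.2.
  have [/lin_span_recl[a [y ?]]|np] := pselect (lin_span e (p t)).
    by exists (a, y).
  by exists (0, 0).
pose a t := (ay t).1; pose y t := (ay t).2.
have aE : \forall t \near F, lin_span e' (y t) /\ p t = a t *: e ord0 + y t.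
  by apply: filterS pe => t /ayE.
(* [a] is the coefficient of the first generator, [y] the rest. *)
have [[N aN]|aN] := pselect (exists N : R, \forall t \near F, `|a t| <= N).
  have [a0 aa0] := ultra_bounded_cvg UF aN.
  have [||l [el yl]] := IH e' y (M + N * `|e ord0|).
  - by apply: filterS aE => t [].
  - apply: filterS3 aE pM aN => t [_ pt] ptM atN.
    have -> : y t = p t - a t *: e ord0 by rewrite pt addrC addKr.
    apply: le_trans (ler_normB _ _) _; rewrite lerD // normrZ.
    exact: ler_wpM2r.
  exists (a0 *: e ord0 + l); split; first by apply/lin_span_recl; exists a0, l.
  apply: (@cvg_trans _ ((fun t => a t *: e ord0 + y t) @ F)).
    by apply: near_eq_cvg; apply: filterS aE => t [_ ->].
  by apply: cvgD => //; exact: cvgZr_tmp.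
(* Along an ultrafilter, [a] not being eventually bounded means that its
   absolute value tends to infinity; then [(a t)^-1 *: y t] tends to [- e ord0]. *)
have aV0 : (a t)^-1 @[t --> F] --> (0 : R).
  apply/cvgrPdist_le => eps eps0.
  have [H|] := in_ultra_setVsetC [set t | `|a t| <= eps^-1] UF.
    by exfalso; apply: aN; exists eps^-1.
  apply: filterS => t /= /negP; rewrite -ltNge => at_gt.
  rewrite sub0r normrN normfV -[leRHS]invrK lef_pV2 ?posrE ?invr_gt0 //.
    exact: ltW.
  by apply: lt_trans at_gt; rewrite invr_gt0.
have a0 : \forall t \near F, a t != 0.
  have [H|] := in_ultra_setVsetC [set t | a t == 0] UF; last first.
    by apply: filterS => t /= /negP.
  exfalso; apply: aN; exists 0.
  by apply: filterS H => t /= /eqP ->; rewrite normr0.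
have Vp0 : (a t)^-1 *: p t @[t --> F] --> (0 : V).
  apply/cvgrPdist_le => eps eps_gt0.
  have M1 : 0 < `|M| + 1 by rewrite ltr_wpDl.
  move/cvgrPdist_le/(_ _ (divr_gt0 eps_gt0 M1)) : aV0.
  apply: filterS2 pM => t ptM; rewrite !sub0r !normrN normrZ => Ha.
  have ptM1 : `|p t| <= `|M| + 1.
    by apply: le_trans ptM (le_trans (ler_norm M) _); rewrite lerDl.
  by rewrite -[eps](@divfK _ (`|M| + 1)) ?gt_eqF // ler_pM.
have Vy : (a t)^-1 *: y t @[t --> F] --> - e ord0.
  apply: (@cvg_trans _ ((fun t => (a t)^-1 *: p t - e ord0) @ F)).
    apply: near_eq_cvg; apply: filterS2 aE a0 => t [_ ->] at0.
    by rewrite scalerDr scalerA mulVf // scale1r addrAC subrr add0r.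
  have Vpe := cvgB Vp0 (cvg_cst (e ord0)); rewrite add0r in Vpe; exact: Vpe.
have [||l [el yl]] := IH e' (fun t => (a t)^-1 *: y t) (`|e ord0| + 1).
- by apply: filterS aE => t [ey _]; exact: lin_spanZ.
- move/cvgrPdist_le/(_ _ ltr01) : Vy.
  apply: filterS => t H.
  rewrite -(subrK (- e ord0) (_ *: _)); apply: le_trans (ler_normD _ _) _.
  by rewrite normrN addrC lerD2l distrC.
have le : l = - e ord0 by apply: (cvg_unique _ yl Vy); exact: norm_hausdorff.
have e0 : lin_span e' (e ord0).
  by rewrite -[e ord0]opprK -le -scaleN1r; exact: lin_spanZ.
have [||l' [el' pl']] := IH e' p M => //.
  apply: filterS aE => t [ey ->].
  by apply: lin_spanD => //; exact: lin_spanZ.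
exists l'; split=> //; apply/lin_span_recl; exists 0, l'.
by rewrite scale0r add0r.
Qed.

End finite_dimension.

(** In a Banach space, a family which, for every [eps > 0], is eventually
    [eps]-close to a bounded part of a finite-dimensional subspace converges
    along ultrafilters. *)
Lemma ultra_almost_finite_dim_cvg (R : realType) (V : completeNormedModType R)
    (T : Type) (F : set_system T) (u : T -> V) : UltraFilter F ->
  (forall eps : R, 0 < eps -> exists (E : set V) (p : T -> V) (M : R),
    finite_dim_subspace E /\
    \forall t \near F, [/\ E (p t), `|p t| <= M & `|u t - p t| <= eps]) ->
  exists l : V, u t @[t --> F] --> l.
Proof.
move=> UF H; suff /cvg_ex : cvg (u @ F) by [].
apply: cauchy_cvg; apply: cauchy_exP.
move=> eps eps0; have e4 : 0 < eps / 4 by rewrite divr_gt0.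
have [E [p [M [[n [e ->]] pE]]]] := H _ e4.
have [||l [_ pl]] := @lin_span_ultra_cvg _ _ n e _ F p M UF.
- by apply: filterS pE => t [].
- by apply: filterS pE => t [].
exists l; move/cvgrPdist_le/(_ _ e4) : pl.
apply: filterS2 pE => t [_ _ up] lp; rewrite -ball_normE /=.
rewrite -(subrK (p t) l) -addrA; apply: le_lt_trans (ler_normD _ _) _.
by rewrite (distrC (p t)); lra.
Qed.

(** A limit along a filter finer than [\oo] is the limit of a sequence of
    values taken at arbitrarily large indices. *)
Lemma cvg_filter_subseq (R : realType) (V : normedModType R)
    (F : set_system nat) (u : nat -> V) (l : V) : ProperFilter F ->
  \oo `<=` F -> u n @[n --> F] --> l ->
  exists k : nat -> nat, (forall n, (n <= k n)%N) /\ u (k n) @[n --> \oo] --> l.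
Proof.
move=> PF ooF ul.
have /choice[k kP] n : exists m, (n <= m)%N /\ `|l - u m| <= n.+1%:R^-1.
  have /(@filter_ex _ F) [] : \forall m \near F,
    (n <= m)%N /\ `|l - u m| <= n.+1%:R^-1; last by move=> m; exists m.
  apply: filterI; first exact: (ooF _ (nbhs_infty_ge n)).
  by move/cvgrPdist_le : ul; apply; rewrite invr_gt0.
exists k; split; first by move=> n; have [] := kP n.
apply/cvgrPdist_le => eps eps0.
have := near_infty_natSinv_lt (PosNum eps0); apply: filterS => n /= /ltW.
by apply: le_trans; have [] := kP n.
Qed.

(** * Weak convergence *)

Lemma dual_spaceB (R : realType) (V : normedModType R) (f : V -> R^o)
    (x y : V) :
  dual_space f -> f (x - y) = f x - f y.
Proof.
by move=> [fl _]; rewrite addrC -scaleN1r fl scaleN1r addrC.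
Qed.

(** Closed balls are weakly closed. *)
Lemma weak_limit_dist_le (R : realType) (V : normedModType R) (T : Type)
    (F : set_system T) {FF : ProperFilter F} (w : T -> V) (l p : V) (eps : R) :
  (forall f : V -> R^o, dual_space f -> f (w t) @[t --> F] --> f l) ->
  (\forall t \near F, `|w t - p| <= eps) -> `|l - p| <= eps.
Proof.
move=> wl wp; have [f [df fle <-]] := norming_functional (l - p).
have fcvg : (f (w t - p) : R) @[t --> F] --> (f (l - p) : R).
  rewrite dual_spaceB //; under eq_fun do rewrite dual_spaceB //.
  apply: cvgB; [exact: wl|exact: cvg_cst].
have fle' : \forall t \near F, (f (w t - p) : R) <= eps.
  by apply: filterS wp => t; exact: le_trans (fle _).
exact: (@cvgr_to_le _ _ _ R _ _ _ fcvg fle').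
Qed.

Section weak_convergence.
Context {R : realType} {V : normedModType R}.

Lemma dual_space0 (f : V -> R^o) : dual_space f -> f 0 = 0.
Proof. by move=> df; rewrite -(subrr (0 : V)) dual_spaceB // subrr. Qed.

Lemma dual_spaceZ (f : V -> R^o) (a : R) x :
  dual_space f -> f (a *: x) = a * f x.
Proof.
by move=> df; have := df.1 a x 0; rewrite !addr0 dual_space0 // addr0.
Qed.

(** Convergence against every functional gives convergence in the weak
    topology, along any filter. *)
Lemma weak_cvg_filter (T : Type) (F : set_system T) (w : T -> V) (l : V) :
  Filter F ->
  (forall f : V -> R^o, dual_space f -> f (w t) @[t --> F] --> f l) ->
  (w : T -> weak V) @ F --> (l : weak V).
Proof.
move=> FF wl; rewrite cvg_sup => -[f df] /= A.
rewrite (@nbhsE (initial_topology f)) => -[B [[C oC CB] Bl] BA].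
have Cfl : C (f l) by move: Bl; rewrite -CB.
have wC : \forall t \near F, C (f (w t)).
  exact: (wl f df C (open_nbhs_nbhs (conj oC Cfl))).
by apply: filterS wC => t Ct; apply: BA; rewrite -CB.
Qed.

Lemma dual_norm_has_ubound (f : V -> R^o) : dual_space f ->
  has_ubound [set `|f x| | x in [set x : V | `|x| <= 1]].
Proof.
move=> [flin fcont].
pose fL := HB.pack_for {linear V -> R^o} f
  (GRing.isLinear.Build R V R^o *:%R f flin).
have /linear_boundedP[C [_ HC]] := (linear_bounded_continuous fL).2 fcont.
exists (`|C| + 1) => _ [y /= y1 <-].
have fy : `|f y| <= (C + 1) * `|y| by apply: HC; rewrite ltrDl.
have := ler_norm C; have := normr_ge0 y; have := normr_ge0 C; nra.
Qed.

Lemma dual_norm_ge0 (f : V -> R^o) : dual_space f -> 0 <= dual_norm f.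
Proof.
move=> df; apply: ub_le_sup; first exact: dual_norm_has_ubound.
by exists 0; rewrite /= ?normr0 ?ler01 // dual_space0 // normr0.
Qed.

Lemma dual_norm_le (f : V -> R^o) x :
  dual_space f -> `|f x| <= dual_norm f * `|x|.
Proof.
move=> df; have [->|x0] := eqVneq x 0.
  by rewrite dual_space0 // !normr0 mulr0.
have nx : 0 < `|x| by rewrite normr_gt0.
rewrite -ler_pdivrMr //; apply: ub_le_sup; first exact: dual_norm_has_ubound.
exists (`|x|^-1 *: x) => /=.
  by rewrite normrZ normfV normr_id mulVf // gt_eqF.
by rewrite dual_spaceZ // normrM normfV normr_id mulrC.
Qed.

(** In a reflexive space a bounded family converges weakly along every
    ultrafilter: the limits of its images by the functionals define a bounded
    functional on the dual. *)
Lemma reflexive_ultra_weak_cvg (T : Type) (F : set_system T) (w : T -> V)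
    (M : R) : reflexive_space V -> UltraFilter F ->
  (\forall t \near F, `|w t| <= M) ->
  exists l : V, forall f : V -> R^o, dual_space f ->
    f (w t) @[t --> F] --> f l.
Proof.
move=> refl UF wM.
have fM (f : V -> R^o) : dual_space f ->
    \forall t \near F, `|f (w t)| <= `|M| * dual_norm f.
  move=> df; apply: filterS wM => t wt; apply: le_trans (dual_norm_le _ df) _.
  by rewrite mulrC ler_wpM2r ?dual_norm_ge0 // (le_trans wt) // ler_norm.
(* Functions outside the dual get the arbitrary value 0. *)
have /choice[Phi PhiE] (f : V -> R^o) : exists c : R^o,
    dual_space f -> f (w t) @[t --> F] --> c.
  have [df|nf] := pselect (dual_space f); last by exists 0.
  by have [c fc] := ultra_bounded_cvg UF (fM f df); exists c.
have [|l lE] := refl Phi; last by exists l => f df; rewrite -lE //; exact: PhiE.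
split.
  move=> a f g df dg.
  have dfg : dual_space (a *: f + g).
    split.
    - move=> b x y; rewrite !fctE /= df.1 dg.1.
      by rewrite scalerDr addrACA scalerDr !scalerA (mulrC a).
    - move=> x; apply: cvgD; last exact: dg.2.
      by apply: cvgZl_tmp; exact: df.2.
  apply: (cvg_unique (@norm_hausdorff _ R^o) (PhiE _ dfg)).
  apply: cvgD; last exact: PhiE.
  by apply: cvgZl_tmp; exact: PhiE.
exists `|M| => f df.
have Phin : `|f (w t)| @[t --> F] --> (`|Phi f| : R).
  exact: cvg_norm (PhiE f df).
exact: (@cvgr_to_le _ _ _ R _ _ _ Phin (fM f df)).
Qed.

End weak_convergence.

(** * The Hausdorff semidistance *)

Section semidistance.
Context {R : realType} {V : normedModType R}.
Implicit Types (A B : set V).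

Lemma semidist_lt A B (eps : R) x : (semidist A B < eps%:E)%E -> A x ->
  exists2 y, B y & `|x - y| < eps.
Proof.
move=> AB Ax.
have /ereal_inf_lt[_ [y By <-]] :
    (ereal_inf [set `|x - y|%:E | y in B] < eps%:E)%E.
  apply: le_lt_trans AB; rewrite /semidist le_max; apply/orP; right.
  by apply: ereal_sup_ubound; exists x.
by rewrite lte_fin; exists y.
Qed.

Lemma semidist_le A B (eps : R) : 0 <= eps ->
  (forall x, A x -> exists2 y, B y & `|x - y| <= eps) ->
  (semidist A B <= eps%:E)%E.
Proof.
move=> eps0 AB; rewrite /semidist ge_max lee_fin eps0 /=.
apply: ge_ereal_sup => _ [x Ax <-]; have [y By xy] := AB _ Ax.
apply: (@le_trans _ _ `|x - y|%:E); last by rewrite lee_fin.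
by apply: ereal_inf_lbound; exists y.
Qed.

(** Convergence of the semidistance to 0 in terms of norms. *)
Lemma semidist_cvg0P (A : R -> set V) B :
  semidist (A t) B @[t --> +oo] --> 0%E <->
  forall eps : R, 0 < eps ->
    exists T : R, forall t, T <= t ->
      forall x, A t x -> exists2 y, B y & `|x - y| <= eps.
Proof.
split=> [/fine_cvgP[fin /cvgrPdist_lt H] eps eps0|H].
  have [T [_ HT]] := filterI fin (H _ eps0).
  exists (T + 1) => t Tt x Ax.
  have [|fint] := HT t; first by apply: lt_le_trans Tt; rewrite ltrDl.
  rewrite sub0r normrN => /= st.
  have [|y By xy] := @semidist_lt (A t) B eps x _ Ax.
    by rewrite -(fineK fint) lte_fin (le_lt_trans (ler_norm _)).
  by exists y => //; exact: ltW.
have ge0 t : (0 <= semidist (A t) B)%E by rewrite /semidist le_max lexx.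
have lee eps : 0 < eps -> \forall t \near +oo, (semidist (A t) B <= eps%:E)%E.
  move=> eps0; have [T HT] := H _ eps0; exists T; split; first exact: num_real.
  by move=> t /ltW Tt; apply: semidist_le (ltW eps0) (HT t Tt).
apply/fine_cvgP; split.
  apply: filterS (lee 1 ltr01) => t st.
  by rewrite ge0_fin_numE // (le_lt_trans st) // ltry.
apply/cvgrPdist_le => eps eps0; apply: filterS (lee _ eps0) => t /= st.
rewrite sub0r normrN ger0_norm ?fine_ge0 // -lee_fin fineK //.
by rewrite ge0_fin_numE // (le_lt_trans st) // ltry.
Qed.

End semidistance.

(** * Flattening semiflows *)

Section flattening_semiflow.
Context {R : realType} {H : completeNormedModType R}.
Implicit Types (G : R -> H -> set H) (B : set H).

Lemma flow_tailP G s B y :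
  flow_tail G s B y <-> exists t x, [/\ s <= t, B x & G t x y].
Proof.
split=> [[t st [x Bx Gy]]|[t [x [st Bx Gy]]]]; first by exists t, x.
by exists t => //; exists x.
Qed.

Lemma m_semiflow_split G t s z y : m_semiflow G -> 0 <= t -> 0 <= s ->
  G (t + s) z y -> exists2 x, G s z x & G t x y.
Proof. by move=> Gm t0 s0 /(m_semiflowD Gm t0 s0). Qed.

Lemma flow_tail_split G t s B y : m_semiflow G -> 0 <= t -> 0 <= s ->
  flow_tail G (t + s) B y -> exists2 x, flow_tail G s B x & G t x y.
Proof.
move=> Gm t0 s0 /flow_tailP[r [z [tsr Bz Gy]]].
have [||x Gx xy] := @m_semiflow_split G t (r - t) z y Gm t0.
- by rewrite subr_ge0; apply: le_trans tsr; rewrite lerDl.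
- by rewrite addrC subrK.
by exists x => //; apply/flow_tailP; exists (r - t), z; rewrite lerBrDl.
Qed.

(** Flattening in terms of norms: the tail is [eps]-close to a bounded part of
    [E]. *)
Lemma flattening_approx G B (eps : R) :
  flattening G -> bounded_set B -> 0 < eps ->
  exists (t0 : R) (E : set H) (P : H -> H) (M : R),
    [/\ 0 <= t0, finite_dim_subspace E & forall x, flow_tail G t0 B x ->
      [/\ E (P x), `|P x| <= M & `|x - P x| <= eps]].
Proof.
move=> Gf Bb eps0; have [t0 [E [P [t00 Efd Pp /bounded_setP[M PM] IP]]]] :=
  Gf B eps Bb eps0.
exists t0, E, P, M; split=> // x tx; split.
- exact: bounded_projector_in Pp x.
- by apply: PM; exists x.
- by apply: IP; exists x.
Qed.

Lemma flattening_bounded_tail G B : flattening G -> bounded_set B ->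
  exists2 t0 : R, 0 <= t0 & bounded_set (flow_tail G t0 B).
Proof.
move=> Gf Bb; have [t0 [E [P [M [t00 _ H0]]]]] := flattening_approx Gf Bb ltr01.
exists t0 => //; apply/bounded_setP; exists (M + 1) => x /H0[_ PM xP].
by rewrite -(subrK (P x) x) (le_trans (ler_normD _ _)) // addrC lerD.
Qed.

(** The omega-limit set of [B], the intersection over [s] of the closures of the
    tails of [B] after time [s], with closures expressed by the norm. *)
Definition omega_limit G B : set H :=
  [set z | forall s eps : R, 0 < eps ->
    exists2 y, flow_tail G s B y & `|z - y| <= eps].

(** Asymptotic compactness: a family which eventually comes arbitrarily close to
    every tail of a bounded set converges along ultrafilters. *)
Lemma flattening_ultra_cvg G B (T : Type) (F : set_system T) (u : T -> H) :
  flattening G -> bounded_set B -> UltraFilter F ->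
  (forall s eps : R, 0 < eps -> \forall t \near F,
    exists2 y, flow_tail G s B y & `|u t - y| <= eps) ->
  exists l : H, u t @[t --> F] --> l.
Proof.
move=> Gf Bb UF uF; apply: ultra_almost_finite_dim_cvg => eps eps0.
have e2 : 0 < eps / 2 by rewrite divr_gt0.
have [t0 [E [P [M [t00 Efd HP]]]]] := flattening_approx Gf Bb e2.
have /choice[y yE] (t : T) : exists y,
    (exists2 y, flow_tail G t0 B y & `|u t - y| <= eps / 2) ->
    flow_tail G t0 B y /\ `|u t - y| <= eps / 2.
  have [[y ty uy]|nt] := pselect (exists2 y, flow_tail G t0 B y &
    `|u t - y| <= eps / 2); by [exists y|exists 0].
exists E, (P \o y), M; split=> //.
apply: filterS (uF t0 _ e2) => t /yE[/HP[EP PM yP] uy]; split=> //.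
rewrite -(subrK (y t) (u t)) -addrA (le_trans (ler_normD _ _)) //.
by rewrite [leRHS]splitr lerD.
Qed.

Lemma omega_limit_subseq G B (u : nat -> H) :
  flattening G -> bounded_set B -> (forall n, flow_tail G n%:R B (u n)) ->
  exists (k : nat -> nat) (l : H), [/\ forall n, (n <= k n)%N,
    u (k n) @[n --> \oo] --> l & omega_limit G B l].
Proof.
move=> Gf Bb uB.
have tail_near (s : R) : \forall n \near \oo, flow_tail G s B (u n).
  apply: filterS (nbhs_infty_ger s) => n sn.
  have /flow_tailP[t [x [nt Bx Gu]]] := uB n.
  by apply/flow_tailP; exists t, x; rewrite (le_trans sn).
have [F [UF ooF]] := ultraFilterLemma (F := \oo) _.
have [|l ul] := flattening_ultra_cvg (u := u) Gf Bb UF.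
  move=> s eps eps0; apply: filterS (ooF _ (tail_near s)) => n tn.
  by exists (u n) => //; rewrite subrr normr0 ltW.
have [k [nk ukl]] := cvg_filter_subseq _ ooF ul.
exists k, l; split=> // s eps eps0.
have /(@filter_ex _ F)[n [tn ln]] : \forall n \near F,
    flow_tail G s B (u n) /\ `|l - u n| <= eps.
  apply: filterI; first exact: ooF (tail_near s).
  by move/cvgrPdist_le : ul; apply.
by exists (u n).
Qed.

Lemma omega_limit_compact G B :
  flattening G -> bounded_set B -> compact (omega_limit G B).
Proof.
move=> Gf Bb; rewrite compact_ultra => F UF FA.
have [|l Fl] := flattening_ultra_cvg (u := id) Gf Bb UF.
  by move=> s eps eps0; apply: filterS FA => z /(_ s eps eps0).
exists l; split=> // s eps eps0; have e2 : 0 < eps / 2 by rewrite divr_gt0.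
have Fl' : \forall z \near F, `|l - z| <= eps / 2.
  by move/cvgrPdist_le : Fl; apply.
have [z [/(_ s _ e2)[y ty zy] lz]] := filter_ex (filterI FA Fl').
exists y => //; rewrite -(subrK z l) -addrA (le_trans (ler_normD _ _)) //.
by rewrite [leRHS]splitr lerD.
Qed.

(** The closedness of the graph of [G t] common to both alternatives. The weak
    limit is taken along an ultrafilter, since under reflexivity and
    demiclosedness only a weak cluster point of [w] is needed, and not a weakly
    convergent subsequence. *)
Lemma weakly_closed_graph G (t M : R) (x_ w : nat -> H) (x : H) :
  condition_NW G \/ (reflexive_space H /\ demiclosed G) ->
  0 <= t -> x_ n @[n --> \oo] --> x -> (forall n, G t (x_ n) (w n)) ->
  (forall n, `|w n| <= M) ->
  exists (F : set_system nat) (l : H), [/\ UltraFilter F, \oo `<=` F, G t x l &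
    forall f : H -> R^o, dual_space f -> f (w n) @[n --> F] --> f l].
Proof.
move=> [NW|[refl Gc]] t0 x_x Gw wM.
  have [k [l [kh Gl /weak_cvgP wl]]] := NW t x_ x w t0 x_x Gw.
  have [F [UF kF]] := ultraFilterLemma (F := k @ \oo) _.
  have nk n : (n <= k n)%N.
    by elim: n => // n IH; apply: leq_ltn_trans IH _; apply: kh.
  exists F, l; split=> //.
    apply: subset_trans kF => A [N _ NA]; exists N => // n /= Nn.
    by apply: NA => /=; exact: leq_trans (nk n).
  by move=> f df A /(wl f df); exact: kF.
have [F [UF ooF]] := ultraFilterLemma (F := \oo) _.
have [|l wl] := @reflexive_ultra_weak_cvg _ _ _ F w M refl UF.
  by apply: nearW.
exists F, l; split=> //.
have xwF : (fun n => (x_ n, w n : weak H)) @ F --> (x, l : weak H).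
  apply: (@cvg_pair _ _ _ _ (nbhs x) (nbhs (l : weak H))); last first.
    exact: weak_cvg_filter.
  by apply: cvg_trans x_x; apply: cvg_app.
apply: (@closed_cvg _ _ F _ _ [set p : H * weak H | G t p.1 p.2] (Gc t t0)
  _ _ xwF).
exact: nearW.
Qed.

(** Along a convergent sequence of initial points, the orbits meet a fixed ball
    infinitely often at a common time [s]. The radius [r + 4] depends only on
    that of the dissipativity ball, while [s] depends on the sequence. *)
Lemma flattening_enters_ball G (r : R) (eta : nat -> H) (y : H) :
  flattening G ->
  condition_NW G \/ (reflexive_space H /\ demiclosed G) ->
  (forall x, exists T : R, forall t z, T <= t -> G t x z -> `|z| <= r) ->
  eta n @[n --> \oo] --> y ->
  exists2 s : R, 0 <= s & forall w, (forall n, G s (eta n) (w n)) ->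
    forall N, exists2 n, (N <= n)%N & `|w n| <= r + 4.
Proof.
move=> Gf Gweak Gr etay.
have etab : bounded_set (range eta).
  have [M [_ HM]] := cvg_seq_bounded (cvgP _ etay).
  apply/bounded_setP; exists (M + 1) => _ [n _ <-].
  by apply: HM; rewrite ?ltrDl.
have [t0 [E [P [M [t00 Efd HP]]]]] := flattening_approx Gf etab ltr01.
have [T HT] := Gr y.
pose s := Num.max t0 T.
have s0 : 0 <= s by rewrite le_max t00.
exists s => // w Gw N.
have wt n : flow_tail G t0 (range eta) (w n).
  apply/flow_tailP; exists s, (eta n).
  by split; [rewrite le_max lexx|exists n|exact: Gw].
have wM n : `|w n| <= M + 1.
  have [_ PM wP] := HP _ (wt n).
  by rewrite -(subrK (P (w n)) (w n)) (le_trans (ler_normD _ _)) // addrC lerD.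
have [F [l [UF ooF Gl wl]]] := weakly_closed_graph Gweak s0 etay Gw wM.
have lr : `|l| <= r by apply: HT Gl; rewrite le_max lexx orbT.
have [n [e Ee]] := Efd.
have [||p [_ Pwp]] := @lin_span_ultra_cvg _ _ n e _ F (P \o w) M UF.
- by apply: nearW => m /=; rewrite /lin_span -Ee; have [] := HP _ (wt m).
- by apply: nearW => m /=; have [] := HP _ (wt m).
have wp : \forall n \near F, `|w n - p| <= 2.
  move/cvgrPdist_le/(_ _ ltr01) : Pwp; apply: filterS => m pm.
  have [_ _ wP] := HP _ (wt m).
  rewrite -(subrK (P (w m)) (w m)) -addrA (le_trans (ler_normD _ _)) //.
  by rewrite (distrC _ p); move: pm wP => /=; lra.
have lp : `|l - p| <= 2 by exact: weak_limit_dist_le wl wp.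
have [m [Nm wmp]] := filter_ex (filterI (ooF _ (nbhs_infty_ge N)) wp).
exists m => //.
have := ler_normD (w m - p) p; rewrite subrK.
have := ler_normD (p - l) l; rewrite subrK (distrC p l).
by move: wmp => /=; lra.
Qed.

Lemma point_dissipative_ball G : point_dissipative G -> exists r : R,
  forall x, exists T : R, forall t z, T <= t -> G t x z -> `|z| <= r.
Proof.
move=> [B0 /bounded_setP[M BM] GB]; exists (M + 1) => x.
have [T HT] := (semidist_cvg0P _ _).1 (GB x) 1 ltr01.
exists T => t z Tt Gz; have [y /BM yM zy] := HT t Tt z Gz.
by rewrite -(subrK y z) (le_trans (ler_normD _ _)) // addrC lerD.
Qed.

Lemma flattening_absorbing_set G : m_semiflow G -> flattening G ->
  point_dissipative G ->
  condition_NW G \/ (reflexive_space H /\ demiclosed G) ->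
  exists B1, bounded_absorbing_set G B1.
Proof.
move=> Gm Gf /point_dissipative_ball[r Gr] Gweak.
pose D : set H := [set x | `|x| <= r + 4].
have Db : bounded_set D by apply/bounded_setP; exists (r + 4).
have [t1 t10 B1b] := flattening_bounded_tail Gf Db.
(* If the tail of [D] does not absorb [B], the pairs [my n] consist of a point
   in the tail of [B] after time [n] and of one of its images after a further
   time [n], outside of the tail of [D]. *)
exists (flow_tail G t1 D); split=> // B Bb; apply: contrapT => nabs.
have /choice[my myP] (n : nat) : exists my : H * H,
    [/\ flow_tail G n%:R B my.1, G n%:R my.1 my.2 & ~ flow_tail G t1 D my.2].
  have /existsNP[y /not_implyP[ty nt]] :
      ~ (flow_tail G (n%:R + n.+1%:R) B `<=` flow_tail G t1 D).
    by move=> sub; apply: nabs; exists (n%:R + n.+1%:R) => //; rewrite ltr_wpDl.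
  have [m tm my] := flow_tail_split Gm (ler0n R n) (ler0n R n.+1) ty.
  exists (m, y); split=> //=; have /flow_tailP[t [x [nt' Bx Gx]]] := tm.
  apply/flow_tailP; exists t, x; split=> //.
  by apply: le_trans nt'; rewrite ler_nat.
have [|k [l [nk kl _]]] := omega_limit_subseq (u := fst \o my) Gf Bb.
  by move=> n; have [] := myP n.
have [s s0 Hs] := flattening_enters_ball Gf Gweak Gr kl.
(* [w n] is the intermediate point at time [s] on the way from [(my (k n)).1] to
   [(my (k n)).2]; for the finitely many [n] with [k n < s] it is any point of
   the nonempty set [G s (my (k n)).1]. *)
have /choice[w wP] (n : nat) : exists w, G s (my (k n)).1 w /\
    (s <= (k n)%:R -> G ((k n)%:R - s) w (my (k n)).2).
  have [_ Gk _] := myP (k n).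
  have [sk|ks] := leP s (k n)%:R; last first.
    have [w Gw] := m_semiflow_neq0 Gm (my (k n)).1 s0.
    by exists w; split=> // /le_lt_trans/(_ ks); rewrite ltxx.
  have ks0 : 0 <= (k n)%:R - s by rewrite subr_ge0.
  rewrite -[X in G X _ _](subrK s) in Gk.
  have [w Gw wy] := m_semiflow_split Gm ks0 s0 Gk.
  by exists w.
have [|n Nn wn] := Hs w _ (Num.truncn (s + t1)).+1.
  by move=> n; have [] := wP n.
have kst : s + t1 <= (k n)%:R.
  apply/ltW/(lt_le_trans (truncnS_gt _)); rewrite ler_nat.
  exact: leq_trans (nk n).
have [_ _] := myP (k n); apply; apply/flow_tailP.
exists ((k n)%:R - s), (w n); split=> //; first by rewrite lerBrDl.
by have [_] := wP n; apply; apply: le_trans kst; rewrite lerDl.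
Qed.

(** A point of the omega-limit set is a limit of points of the tails; their
    predecessors at time lag [t] converge along a subsequence, and the graph of
    [G t] is weakly closed. *)
Lemma omega_limit_neg_invariant G B (t : R) : m_semiflow G -> flattening G ->
  condition_NW G \/ (reflexive_space H /\ demiclosed G) ->
  bounded_set B -> 0 <= t ->
  omega_limit G B `<=` flow_image G t (omega_limit G B).
Proof.
move=> Gm Gf Gweak Bb t0 a aw.
have /choice[my myP] (n : nat) : exists my : H * H,
    [/\ flow_tail G n%:R B my.1, G t my.1 my.2 & `|a - my.2| <= n.+1%:R^-1].
  have [|y ty ay] := aw (t + n%:R) n.+1%:R^-1; first by rewrite invr_gt0.
  by have [m tm my] := flow_tail_split Gm t0 (ler0n R n) ty; exists (m, y).
have [|k [b [nk kb bw]]] := omega_limit_subseq (u := fst \o my) Gf Bb.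
  by move=> n; have [] := myP n.
pose w n := (my (k n)).2.
have aw_le n : `|a - w n| <= n.+1%:R^-1.
  have [_ _ ay] := myP (k n); apply: le_trans ay _.
  by rewrite lef_pV2 ?posrE ?ltr0n // ler_nat ltnS.
have wM n : `|w n| <= `|a| + 1.
  have aw1 : `|a - w n| <= 1.
    by apply: le_trans (aw_le n) _; rewrite invf_le1 // ler1n.
  by rewrite -(subrK a (w n)) (le_trans (ler_normD _ _)) // addrC lerD2l distrC.
have [|F [l [UF ooF Gl wl]]] := weakly_closed_graph Gweak t0 kb _ wM.
  by move=> n; have [] := myP (k n).
(* The norm limit [a] of [w] is its weak limit. *)
exists b => //; suff <- : l = a by [].
apply/eqP; rewrite -subr_eq0 -normr_le0; apply/ler_addgt0Pr => eps eps0.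
rewrite add0r; apply: (weak_limit_dist_le wl).
apply: ooF; have := near_infty_natSinv_lt (PosNum eps0).
by apply: filterS => n /= /ltW; rewrite distrC; apply: le_trans.
Qed.

Lemma omega_limit_attracts G B1 B : m_semiflow G -> flattening G ->
  bounded_absorbing_set G B1 -> bounded_set B ->
  semidist (flow_image G t B) (omega_limit G B1) @[t --> +oo] --> 0%E.
Proof.
move=> Gm Gf [B1b B1abs] Bb; apply/semidist_cvg0P => eps eps0.
have [t0 t00 tB1] := B1abs B Bb.
apply: contrapT => natt.
have /choice[u uP] (n : nat) : exists u, flow_tail G n%:R B1 u /\
    forall y, omega_limit G B1 y -> eps < `|u - y|.
  have /existsNP[t /not_implyP[tn /existsNP[u /not_implyP[tu nu]]]] :=
    (forallNP _).2 natt (n%:R + t0).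
  exists u; split; last first.
    by move=> y wy; rewrite ltNge; apply/negP => uy; apply: nu; exists y.
  have [|m tm mu] := flow_tail_split Gm (ler0n R n) (ltW t00) (B := B) (y := u).
    by exists t.
  by apply/flow_tailP; exists n%:R, m; split=> //; exact: tB1.
have [|k [l [nk kl lw]]] := omega_limit_subseq (u := u) Gf B1b.
  by move=> n; have [] := uP n.
have /(@filter_ex _ \oo)[n ln] : \forall n \near \oo, `|l - u (k n)| <= eps.
  by move/cvgrPdist_le : kl; apply.
have [_ /(_ _ lw)] := uP (k n); rewrite distrC => /lt_le_trans/(_ ln).
by rewrite ltxx.
Qed.

End flattening_semiflow.

Theorem theorem2p4 (R : realType) (H : completeNormedModType R)
    (G : R -> H -> set H) :
  m_semiflow G ->
  flattening G ->
  point_dissipative G ->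
  (condition_NW G \/ (reflexive_space H /\ demiclosed G)) ->
  (exists B1 : set H, bounded_absorbing_set G B1) /\
  (exists A : set H, global_attractor G A).
Proof.
move=> Gm Gf Gd Gweak.
have [B1 absB1] := flattening_absorbing_set Gm Gf Gd Gweak.
have [B1b _] := absB1; split; first by exists B1.
exists (omega_limit G B1); split.
- exact: omega_limit_compact.
- by move=> t; exact: omega_limit_neg_invariant.
- by move=> B; exact: omega_limit_attracts.
Qed.
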